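(* For every integer $n\ge 5$ there exists an $(n^2,\lfloor n/2\rfloor)$-array that is not layerable.
   Context: $[n]=\{1,2,\dots,n\}$. For positive integers $n,d,k$, an $(n^d,k)$-array is a $d$-dimensional array of dimensions $n\times n\times\cdots\times n$ such that each entry is a subset of $[n]$ of cardinality exactly $k$, and every number in $[n]$ occurs in exactly $k$ of the entries along any axis-parallel line of the array (an axis-parallel line is the set of $n$ cells obtained by fixing all coordinates but one). A layer of an $(n^d,k)$-array is a choice of one element from the set in each cell such that each symbol of $[n]$ is chosen at most once (equivalently exactly once) along every axis-parallel line. The array is layerable if its entries can be partitioned into $k$ layers, i.e. there are $k$ layers such that every element of every cell's set is chosen in exactly one of them. *)

(* Defs.v *)
From mathcomp Require Import all_boot.
Set Implicit Arguments. Unset Strict Implicit. Unset Printing Implicit Defensive.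

(* Symbols [n] = {1..n} are represented by 'I_n = {0..n-1}.
   Cells of an n x ... x n (d times) array are functions 'I_d -> 'I_n. *)
Definition cell (n d : nat) := {ffun 'I_d -> 'I_n}.

Definition array (n d : nat) := cell n d -> {set 'I_n}.

Definition same_line (n d : nat) (i : 'I_d) (c c' : cell n d) : bool :=
  [forall j : 'I_d, (j != i) ==> (c' j == c j)].

Definition is_array (n d k : nat) (A : array n d) : Prop :=
  (forall c : cell n d, #|A c| = k) /\
  (forall (i : 'I_d) (c : cell n d) (s : 'I_n),
      #|[set c' : cell n d | same_line i c c' & s \in A c']| = k).

Definition is_layer (n d : nat) (A : array n d) (L : cell n d -> 'I_n) : Prop :=
  (forall c, L c \in A c) /\
  (forall (i : 'I_d) (c c' : cell n d),
      same_line i c c' -> L c = L c' -> c = c').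

Definition layerable (n d k : nat) (A : array n d) : Prop :=
  exists L : 'I_k -> cell n d -> 'I_n,
    (forall t, is_layer A (L t)) /\
    (forall c (s : 'I_n), s \in A c -> #|[set t : 'I_k | L t c == s]| = 1).

(* Main.v *)
(** Let k = n./2. View an (n^2,k)-array as a 0-1 tensor T on rows x columns x
    symbols all of whose axis-parallel lines sum to k, and split the rows, the
    columns and the symbols into two blocks each. In the base tensor one block
    of rows r meets one block of columns (essentially) only in the symbol named
    r, as far as a given block C of symbols is concerned, and every layer must
    use a symbol of C there exactly once in each such row and column. Now trade
    the symbols a and b between the rows a and b inside two columns, one of them
    q in that block. Line sums do not change, but symbol b now occurs in row a,
    column q, and no layer can choose it: row b would have to contribute its own
    C-symbol in a column other than q, hence a second b, and then b would be
    used in more rows than there are columns available for it. *)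
Require Import Defs.
From mathcomp Require Import all_boot.
From mathcomp Require Import perm ssralg zmodp zify.

Set Implicit Arguments.
Unset Strict Implicit.
Unset Printing Implicit Defensive.

Import GRing.Theory.

(** * Regular tensors over finite types and their passage to arrays *)

Definition regular (k : nat) (I J S : finType) (T : I -> J -> S -> bool) : Prop :=
  [/\ forall i j, #|[pred s | T i j s]| = k,
      forall i s, #|[pred j | T i j s]| = k
    & forall j s, #|[pred i | T i j s]| = k].

Definition latin (I J S : finType) (L : I -> J -> S) : Prop :=
  (forall i, injective (L i)) /\ (forall j, injective (L^~ j)).

Definition unlayered (I J S : finType) (T : I -> J -> S -> bool) i0 j0 s0 : Prop :=
  T i0 j0 s0 /\
  forall L, latin L -> (forall i j, T i j (L i j)) -> L i0 j0 <> s0.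

Lemma ord_bij (X : finType) n :
  #|X| = n -> {f : X -> 'I_n & {g | cancel f g & cancel g f}}.
Proof.
move=> <-; exists enum_rank, enum_val; [exact: enum_rankK | exact: enum_valK].
Qed.

Definition mk_cell n (x y : 'I_n) : cell n 2 :=
  [ffun d : 'I_2 => if d == ord0 then x else y].

Lemma mk_cell0 n (x y : 'I_n) : mk_cell x y ord0 = x.
Proof. by rewrite ffunE. Qed.

Lemma mk_cell1 n (x y : 'I_n) : mk_cell x y ord_max = y.
Proof. by rewrite ffunE. Qed.

Lemma ord2P (d : 'I_2) : d = ord0 \/ d = ord_max.
Proof. by case: d => [[|[|//]]] p; [left | right]; apply: val_inj. Qed.

Lemma mk_cellK n (c : cell n 2) : mk_cell (c ord0) (c ord_max) = c.
Proof. by apply/ffunP=> d; case: (ord2P d) => ->; rewrite ffunE. Qed.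

Lemma same_line0 n (c c' : cell n 2) :
  same_line ord0 c c' = (c' ord_max == c ord_max).
Proof.
apply/forallP/idP => [/(_ ord_max) //|e d].
by case: (ord2P d) => ->; rewrite //= e implybT.
Qed.

Lemma same_line1 n (c c' : cell n 2) :
  same_line ord_max c c' = (c' ord0 == c ord0).
Proof.
apply/forallP/idP => [/(_ ord0) //|e d].
by case: (ord2P d) => ->; rewrite //= e implybT.
Qed.

Lemma card_can_pred (X Y : finType) (f : X -> Y) (g : Y -> X) (P : pred X) :
  cancel f g -> cancel g f -> #|[pred y | P (g y)]| = #|P|.
Proof.
move=> fK gK; rewrite -(card_image (can_inj fK)); apply: eq_card => y.
by rewrite -[y in RHS]gK (mem_image (can_inj fK)).
Qed.

(** A layering covers every entry, so some layer would choose [h s0] in the cell of [i0] and [j0].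
    Pulled back along the bijections, that layer is a latin selection of the kind [unlayered]
    excludes. *)
Lemma unlayered_array (k n : nat) (I J S : finType) (T : I -> J -> S -> bool)
    i0 j0 s0 :
  #|I| = n -> #|J| = n -> #|S| = n -> regular k T -> unlayered T i0 j0 s0 ->
  exists A : array n 2, is_array k A /\ ~ layerable k A.
Proof.
move=> /ord_bij[f [f' fK f'K]] /ord_bij[g [g' gK g'K]] /ord_bij[h [h' hK h'K]].
move=> [Tcell Trow Tcol] [T0 TL].
exists (fun c => [set s | T (f' (c ord0)) (g' (c ord_max)) (h' s)]); split.
  split=> [c|d c s].
    rewrite cardsE -[RHS](Tcell (f' (c ord0)) (g' (c ord_max))).
    exact: (card_can_pred (fun s => T _ _ s) hK h'K).
  case: (ord2P d) => ->.
  - rewrite -(Tcol (g' (c ord_max)) (h' s)).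
    rewrite -(card_can_pred _ fK f'K) -(@card_imset _ _ (fun x : 'I_n => mk_cell x (c ord_max))).
    + apply: eq_card => c'; rewrite !inE same_line0; apply/andP/imsetP.
      * case=> /eqP e Tc; exists (c' ord0); last by rewrite -e mk_cellK.
        by rewrite !inE -e.
      * by case=> x; rewrite !inE => Tx ->; rewrite mk_cell0 mk_cell1.
    + by move=> x y /(congr1 (fun c : cell n 2 => c ord0)); rewrite !mk_cell0.
  - rewrite -(Trow (f' (c ord0)) (h' s)).
    rewrite -(card_can_pred _ gK g'K) -(@card_imset _ _ (mk_cell (c ord0))).
    + apply: eq_card => c'; rewrite !inE same_line1; apply/andP/imsetP.
      * case=> /eqP e Tc; exists (c' ord_max); last by rewrite -e mk_cellK.
        by rewrite !inE -e.
      * by case=> x; rewrite !inE => Tx ->; rewrite mk_cell0 mk_cell1.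
    + by move=> x y /(congr1 (fun c : cell n 2 => c ord_max)); rewrite !mk_cell1.
case=> L [Llayer Lcover].
have /card_gt0P[t] : 0 < #|[set t | L t (mk_cell (f i0) (g j0)) == h s0]|.
  by rewrite Lcover // inE mk_cell0 mk_cell1 fK gK hK.
rewrite inE => /eqP Lt; have [LA Linj] := Llayer t.
apply: (TL (fun i j => h' (L t (mk_cell (f i) (g j))))); last by rewrite Lt hK.
  split=> [i x y|j x y] /(can_inj h'K).
    move/(Linj ord_max); rewrite same_line1 !mk_cell0 eqxx => /(_ isT).
    by move/(congr1 (fun c : cell n 2 => c ord_max)); rewrite !mk_cell1 => /(can_inj gK).
  move/(Linj ord0); rewrite same_line0 !mk_cell1 eqxx => /(_ isT).
  by move/(congr1 (fun c : cell n 2 => c ord0)); rewrite !mk_cell0 => /(can_inj fK).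
move=> i j; have := LA (mk_cell (f i) (g j)).
by rewrite inE mk_cell0 mk_cell1 fK gK.
Qed.

(** * A pigeonhole obstruction to layers *)

Lemma leq_card_inj_in (X Y : finType) (F : X -> Y) (A : {set X}) (B : {set Y}) :
  injective F -> (forall x, x \in A -> F x \in B) -> #|A| <= #|B|.
Proof.
move=> Finj FAB; rewrite -(card_imset _ Finj); apply: subset_leq_card.
by apply/subsetP=> _ /imsetP[x /FAB Fx ->].
Qed.

(* The pigeonhole argument. Row r1 has a C-entry in some column j of B, since
   |~: C| < |B|. Here j <> j0, as otherwise column j0 would have C-entries in the
   rows of A and in r0 and r1. So the entry is s0, and now s0 lies inside the
   columns of B in the rows of A1 and in r0 and r1, which is too often. *)
Lemma unlayeredI (I J S : finType) (T : I -> J -> S -> bool)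
    (A A1 : {set I}) (B : {set J}) (C : {set S}) r0 r1 j0 s0 :
  #|J| = #|S| -> T r0 j0 s0 -> r0 != r1 -> j0 \in B -> s0 \in C ->
  r0 \notin A -> r1 \notin A -> A1 \subset A ->
  #|~: C| < #|B| -> #|C| < #|A|.+2 -> #|B| < #|A1|.+2 ->
  (forall i s, i \in A -> T i j0 s -> s \in C) ->
  (forall i j, i \in A1 -> T i j s0 -> j \in B) ->
  (forall j s, j \in B -> j != j0 -> s \in C -> T r1 j s -> s = s0) ->
  unlayered T r0 j0 s0.
Proof.
move=> cardJS T0 r01 Bj0 Cs0 Ar0 Ar1 /subsetP sA1A ltCB ltCA ltBA1 TA TA1 Tr1.
split=> // L [Lrow Lcol] LT L0.
have addr (X : {set I}) : (forall i, i \in X -> i \in A) -> #|r0 |: (r1 |: X)| = #|X|.+2.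
  move=> XA; rewrite !cardsU1 !inE negb_or r01.
  by rewrite (contra (XA r0) Ar0) (contra (XA r1) Ar1).
have [j Bj CL] : exists2 j, j \in B & L r1 j \in C.
  apply/exists_inP; apply: contraTT ltCB; rewrite negb_exists_in -leqNgt.
  move=> /forall_inP LC; apply: (leq_card_inj_in (Lrow r1)) => j /LC.
  by rewrite inE.
have jj0 : j != j0.
  apply/negP=> /eqP e; move: ltCA; rewrite -(addr A) // ltnNge => /negP; apply.
  apply: (leq_card_inj_in (Lcol j0)) => i; rewrite !inE => /or3P[/eqP->|/eqP->|Ai].
  - by rewrite L0.
  - by rewrite -e.
  - exact: TA Ai (LT _ _).
have Ljs := Tr1 _ _ Bj jj0 CL (LT _ _).
(* Rows of [L] are injective between sets of equal size, hence onto: [s0] is used in every row, and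
   [c i] below is its column there. *)
have colP i : exists j, L i j == s0.
  have [|g _ gK] := inj_card_bij (Lrow i); first by rewrite cardJS.
  by exists (g s0); rewrite gK.
pose c i := xchoose (colP i).
have Lc i : L i (c i) = s0 by apply/eqP; exact: xchooseP (colP i).
have cE i j' : L i j' = s0 -> c i = j' by rewrite -(Lc i) => /Lrow.
have cinj : injective c.
  by move=> x y e; apply: (Lcol (c x)); rewrite Lc e Lc.
move: ltBA1; rewrite -(addr A1 sA1A) ltnNge => /negP; apply.
apply: (leq_card_inj_in cinj) => i; rewrite !inE => /or3P[/eqP->|/eqP->|A1i].
- by rewrite (cE _ _ L0).
- by rewrite (cE _ _ Ljs).
- by apply: TA1 A1i _; have := LT i (c i); rewrite Lc.
Qed.

(** * Counting over two-block index types, and the symbol trade *)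

Lemma card_pred_sum (X Y : finType) (P : pred (X + Y)) :
  #|P| = #|[pred x | P (inl x)]| + #|[pred y | P (inr y)]|.
Proof. by rewrite -!sum1_card big_sumType. Qed.

Lemma card_const k (c : bool) : #|[pred _ : 'I_k | c]| = k * c.
Proof.
case: c; rewrite ?muln1 ?muln0; last exact: eq_card0.
by rewrite -[RHS](card_ord k); apply: eq_card.
Qed.

Lemma card_fiber (X : finType) (Y : eqType) (f : X -> Y) (y : Y) :
  injective f -> #|[pred x | y == f x]| = (y \in codom f).
Proof.
move=> finj; case: codomP => [[x ->]|nfy].
  by rewrite /= -(card1 x); apply: eq_card => z; rewrite !inE (inj_eq finj) eq_sym.
by apply: eq_card0 => x; rewrite !inE; apply/eqP=> e; apply: nfy; exists x.
Qed.

Lemma card_fiberC (X : finType) (Y : eqType) (f : X -> Y) (y : Y) :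
  injective f -> #|[pred x | y != f x]| = #|X| - (y \in codom f).
Proof. by move=> finj; rewrite -(card_fiber y finj) -(cardC [pred x | y == f x]) addKn; apply: eq_card. Qed.

(** Sends a row to its distinguished symbol in column [j]: the one of its own name, except that rows
    [a] and [b] exchange theirs in column [q]. *)
Definition column_swap (X Y : finType) (a b : X) (q j : Y) : {perm X} :=
  if j == q then tperm a b else 1%g.

(** * Even order, n = 2k *)

(* n = 2k: among the symbols, [inl None] and [inl (Some i)] form the block C of
   size k + 1, the [inr] ones its complement of size k - 1. *)
Definition even_tensor (k : nat) (r : 'I_k -> {perm 'I_k})
    (i j : 'I_k + 'I_k) (s : option 'I_k + 'I_k.-1) : bool :=
  match i, j, s with
  | inl i, inl _, inl s => s != Some i
  | inl _, inl _, inr _ => false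
  | inl i, inr _, inl s => s == Some i
  | inl _, inr _, inr _ => true
  | inr i, inl j, inl s => s == Some (r j i)
  | inr _, inl _, inr _ => true
  | inr i, inr j, inl s => s != Some (r j i)
  | inr _, inr _, inr _ => false
  end.

Lemma codom_Some_perm (X : finType) (r : {perm X}) (s : option X) :
  (s \in codom (Some \o r)) = (s != None).
Proof.
case: s => [x|]; last by apply/codomP=> -[].
by apply/codomP; exists (r^-1%g x); rewrite /= permKV.
Qed.

(** Any family [r] works: columns [inl j] and [inr j] are complementary in a row [inr i] on the
    [inl] symbols, and within a column [Some \o r j] hits each symbol but [None] exactly once, just
    as [Some] does. *)
Lemma even_regular k (r : 'I_k -> {perm 'I_k}) :
  0 < k -> regular k (even_tensor r).
Proof.
move=> k0.
have inj_Some_perm (u : {perm 'I_k}) : injective (Some \o u).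
  by apply: inj_comp perm_inj; move=> ? ? [].
have inj_Some : injective (@Some 'I_k) by move=> ? ? [].
have codom_Some (s : option 'I_k) : (s \in codom Some) = (s != None).
  by case: s => [x|]; apply/codomP; [exists x | case].
split.
- move=> [i|i] [j|j]; rewrite card_pred_sum /= card_const ?card1 ?cardC1;
  rewrite ?card_option ?card_ord; lia.
- move=> [i|i] [s|s]; rewrite card_pred_sum /=.
  + by rewrite !card_const; case: eqP => _ /=; lia.
  + by rewrite !card_const; lia.
  + rewrite -[RHS](card_ord k) -(cardC [pred j | s == Some (r j i)]).
    by congr addn; apply: eq_card.
  + by rewrite !card_const; lia.
- move=> [j|j] [s|s]; rewrite card_pred_sum /=.
  + rewrite card_fiberC // (card_fiber s (inj_Some_perm _)) codom_Some codom_Some_perm.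
    by rewrite card_ord; case: s => //=; lia.
  + by rewrite !card_const; lia.
  + rewrite card_fiber // (card_fiberC s (inj_Some_perm _)) codom_Some codom_Some_perm.
    by rewrite card_ord; case: s => //=; lia.
  + by rewrite !card_const; lia.
Qed.

Lemma even_unlayered k (a b q : 'I_k) : a != b ->
  unlayered (even_tensor (column_swap a b q)) (inr a) (inl q) (inl (Some b)).
Proof.
move=> ab.
have k0 : 0 < k by apply: leq_ltn_trans (ltn_ord q).
have cardl (X Y : finType) : #|(@inl X Y) @: [set: X]| = #|X|.
  by rewrite card_imset ?cardsT // => ? ? [].
have cardlC (X Y : finType) : #|~: ((@inl X Y) @: [set: X])| = #|Y|.
  by apply: (@addnI #|X|); rewrite -{1}(cardl X Y) cardsC card_sum.
(* [A1] omits row [inl b], the only row of [A] with symbol [b] outside the columns of [B]. The sizes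
   of [A], [A1], [B], [C] are k, k - 1, k, k + 1. *)
apply: (@unlayeredI _ _ _ _ (inl @: [set: 'I_k]) (inl @: [set~ b])
  (inl @: [set: 'I_k]) (inl @: [set: option 'I_k]) _ (inr b)).
- by rewrite !card_sum card_option !card_ord; lia.
- by rewrite /= /column_swap eqxx tpermL.
- by apply: contraNneq ab => -[->].
- by rewrite mem_imset // => ? ? [].
- by rewrite mem_imset // => ? ? [].
- by apply/imsetP=> -[].
- by apply/imsetP=> -[].
- by apply: imsetS; apply: subsetT.
- by rewrite cardlC cardl !card_ord; lia.
- by rewrite !cardl card_option card_ord.
- by rewrite cardl card_imset ?cardsC1 ?card_ord //= => [|? ? []//]; lia.
- by move=> _ [s|s] /imsetP[i _ ->] //=; rewrite mem_imset // => ? ? [].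
- move=> _ [j|j] /imsetP[i ib ->] /=; first by rewrite mem_imset // => ? ? [].
  by move: ib; rewrite !inE => /negPf ib /eqP[bi]; rewrite bi eqxx in ib.
- move=> _ _ /imsetP[j _ ->] jq /imsetP[s _ ->] /=.
  rewrite /column_swap; case: (j =P q) jq => [->|_ _]; first by rewrite eqxx.
  by rewrite perm1 => /eqP ->.
Qed.

(** * Odd order, n = 2k + 1 *)

(* n = 2k + 1: the [inr] indices are the residues mod k + 1, and [inl i] stands
   for the nonzero residue [lift ord0 i]. *)
Definition odd_tensor (k : nat) (t : 'I_k -> {perm 'I_k.+1}) (r : 'I_k.+1 -> {perm 'I_k.+1})
    (i j s : 'I_k + 'I_k.+1) : bool :=
  match i, j, s with
  | inl _, inl _, inl _ => true
  | inl _, inl _, inr _ => false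
  | inl _, inr _, inl _ => false
  | inl i, inr j, inr s => s != (j + lift ord0 i)%R
  | inr _, inl _, inl _ => false
  | inr i, inl j, inr s => s != t j i
  | inr i, inr j, inl s => j != (i + lift ord0 s)%R
  | inr i, inr j, inr s => (i != j) && (s == r j i)
  end.

Lemma codom_add_lift k (i j : 'I_k.+1) :
  (j \in codom (fun s : 'I_k => i + lift ord0 s)%R) = (i != j).
Proof.
apply/codomP/idP => [[s ->]|ij].
  by rewrite -{1}[i]addr0 (inj_eq (addrI i)) neq_lift.
have : (j - i)%R != ord0 by rewrite subr_eq0 eq_sym.
rewrite eq_sym => /unlift_some[s e _]; exists s.
by rewrite -e addrC subrK.
Qed.

(** In a row [inr i], column [inl p] lacks symbol [u i] and column [inr q] has it, so the two
    changes cancel. Row [q] has no [inr] symbol in column [q] to compensate with, whence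
    [u q = q]. *)
Lemma odd_regular k (t : 'I_k -> {perm 'I_k.+1}) (r : 'I_k.+1 -> {perm 'I_k.+1})
    (u : {perm 'I_k.+1}) (p : 'I_k) (q : 'I_k.+1) :
  u q = q -> t p = u -> (forall l, l != p -> t l = 1%g) ->
  r q = u -> (forall j, j != q -> r j = 1%g) -> regular k (odd_tensor t r).
Proof.
move=> uq tp t1 rq r1.
have injD (i : 'I_k.+1) : injective (fun s : 'I_k => i + lift ord0 s)%R.
  by move=> x y /addrI/lift_inj.
have injDl (x : 'I_k.+1) : injective (fun j : 'I_k.+1 => j + x)%R by apply: addIr.
have onto (f : 'I_k.+1 -> 'I_k.+1) s : injective f -> s \in codom f.
  by move=> finj; apply: inj_card_onto.
have rjj j : r j j = j.
  by have [->|/r1->] := eqVneq j q; rewrite ?rq ?perm1.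
split.
- move=> [i|i] [j|j]; rewrite card_pred_sum /= ?card_const ?cardC1 ?card_ord /=; try lia.
  rewrite card_fiberC // codom_add_lift card_ord.
  case: (i != j) => /=; last by rewrite card_const; lia.
  by rewrite card1; have := ltn_ord p; lia.
- move=> [i|i] [s|s]; rewrite card_pred_sum /= ?card_const ?card_ord; try lia.
  + by rewrite card_fiberC // onto // card_ord; lia.
  + by rewrite cardC1 card_ord; lia.
  + rewrite (cardD1 p) !inE tp.
    have -> : #|[predD1 [pred l | s != t l i] & p]| = k.-1 * (s != i).
      have := cardC1 p; rewrite card_ord => <-; case: (s =P i) => [si|/eqP si].
        rewrite muln0; apply: eq_card0 => l; rewrite !inE.
        by case: eqP => //= /eqP/t1 ->; rewrite perm1 si eqxx.
      rewrite muln1; apply: eq_card => l; rewrite !inE.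
      by case: eqP => //= /eqP/t1 ->; rewrite perm1.
    rewrite (cardD1 q) !inE rq.
    (* Columns other than [i] and [q] contribute; these two may coincide, hence [k - (i != q)]. *)
    have -> : #|[predD1 [pred j | (i != j) && (s == r j i)] & q]| =
              (k - (i != q)) * (s == i).
      have := cardC (pred2 i q); rewrite card2 card_ord => cC.
      case: (s =P i) => [si|/eqP si]; last first.
        rewrite muln0; apply: eq_card0 => j; rewrite !inE.
        by case: eqP => //= /eqP/r1 ->; rewrite perm1 (negPf si) andbF.
      rewrite muln1; have -> : k - (i != q) = #|[predC pred2 i q]| by rewrite -subSS -[X in X - _]cC addKn.
      apply: eq_card => j; rewrite !inE negb_or.
      have [->|jq] /= := eqVneq j q; first by rewrite andbF.
      by rewrite (r1 _ jq) perm1 si eqxx !andbT eq_sym.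
    have := ltn_ord p; case: (i =P q) => [->|/eqP iq].
      by rewrite uq; case: (s == q) => /=; lia.
    by case: (s == i); case: (s == u i) => /=; lia.
- move=> [j|j] [s|s]; rewrite card_pred_sum /= ?card_const ?card_ord; try lia.
  + by rewrite (card_fiberC s perm_inj) onto ?card_ord //; [lia | exact: perm_inj].
  + by rewrite card_fiberC // onto // card_ord; lia.
  + have -> : #|[pred i | (i != j) && (s == r j i)]| = (s != j).
      case: eqP => [->|/eqP sj].
        apply: eq_card0 => i; rewrite !inE; apply/andP=> -[/eqP ij /eqP].
        by rewrite -{1}(rjj j) => /perm_inj/esym.
      have := card_fiber s (@perm_inj _ (r j)); rewrite onto => [<-|]; last exact: perm_inj.
      apply: eq_card => i; rewrite !inE; apply: andb_idl => /eqP si.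
      by apply: contraNneq sj => ij; rewrite si ij rjj.
    rewrite card_fiberC // codom_add_lift card_ord eq_sym.
    by have := ltn_ord p; case: (s != j) => /=; lia.
Qed.

Lemma odd_unlayered k (a b q : 'I_k.+1) (p : 'I_k) : a != b -> a != q ->
  unlayered (odd_tensor (column_swap a b p) (column_swap a b q)) (inr a) (inr q) (inr b).
Proof.
move=> ab aq.
have cardl (X Y : finType) : #|(@inl X Y) @: [set: X]| = #|X|.
  by rewrite card_imset ?cardsT // => ? ? [].
have cardr (X Y : finType) : #|(@inr X Y) @: [set: Y]| = #|Y|.
  by rewrite card_imset ?cardsT // => ? ? [].
have cardrC (X Y : finType) : #|~: ((@inr X Y) @: [set: Y])| = #|X|.
  by apply: (@addnI #|Y|); rewrite -{1}(cardr X Y) cardsC card_sum addnC.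
(* Here [A1 = A]: rows [inl] have [inr] symbols only in columns [inr]. The sizes of [A], [B], [C]
   are k, k + 1, k + 1. *)
apply: (@unlayeredI _ _ _ _ (inl @: [set: 'I_k]) (inl @: [set: 'I_k])
  (inr @: [set: 'I_k.+1]) (inr @: [set: 'I_k.+1]) _ (inr b)) => //.
- by rewrite /= /column_swap eqxx tpermL aq eqxx.
- by rewrite mem_imset // => ? ? [].
- by rewrite mem_imset // => ? ? [].
- by apply/imsetP=> -[].
- by apply/imsetP=> -[].
- by rewrite cardrC cardr !card_ord.
- by rewrite cardl cardr !card_ord.
- by rewrite cardl cardr !card_ord.
- by move=> _ [s|s] /imsetP[i _ ->] //= _; rewrite mem_imset // => ? ? [].
- by move=> _ [j|j] /imsetP[i _ ->] //= _; rewrite mem_imset // => ? ? [].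
- move=> _ _ /imsetP[j _ ->] jq /imsetP[s _ ->] /= /andP[_].
  rewrite /column_swap; case: (j =P q) jq => [->|_ _]; first by rewrite eqxx.
  by rewrite perm1 => /eqP ->.
Qed.

Theorem theorem8 (n : nat) : 5 <= n ->
  exists A : array n 2, is_array (n./2) A /\ ~ layerable (n./2) A.
Proof.
move=> n5; have k1 : 1 < n./2 := half_leq (ltnW n5).
have nE := odd_double_half n; move: (n./2) k1 nE => k k1; have k0 := ltnW k1.
case: (odd n) => nE.
(* The residues 0, 1 and k are distinct since k > 1, so [tperm a b] fixes [q]. *)
- pose a : 'I_k.+1 := ord0; pose b : 'I_k.+1 := Ordinal (leqW k1); pose q : 'I_k.+1 := ord_max.
  have [ab aq bq] : [/\ a != b, a != q & b != q] by split; rewrite neq_ltn /= ?k0 ?k1.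
  pose p := Ordinal k0.
  apply: unlayered_array (odd_regular (u := tperm a b) (p := p) (q := q) _ _ _ _ _)
    (odd_unlayered p ab aq).
  all: rewrite ?card_sum ?card_ord; try lia.
  + by rewrite (tpermD aq bq).
  + by rewrite /column_swap eqxx.
  + by move=> l lp; rewrite /column_swap (negPf lp).
  + by rewrite /column_swap eqxx.
  + by move=> j jq; rewrite /column_swap (negPf jq).
- apply: unlayered_array (even_regular _ _)
    (even_unlayered (a := Ordinal k0) (b := Ordinal k1) (Ordinal k0) _) => //.
  all: by rewrite ?card_sum ?card_option ?card_ord; lia.
Qed.
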